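(* Let $G$ be an undirected graph with vertex set $\{1,\ldots,n\}$, let $A$ be its adjacency matrix, and let $\chi$ be its chromatic number. Then $$\chi\;\ge\;1+\max_W\;\max_{m=1,\ldots,n-1}\left\{\frac{\sum_{i=1}^m \mu_i(W*A)}{-\sum_{i=1}^m \mu_{n-i+1}(W*A)}\right\},$$ where $W$ ranges over all self-adjoint ($n\times n$, complex) matrices, and $\mu_1(W*A),\ldots,\mu_n(W*A)$ are the eigenvalues (counted with multiplicity) of the Schur product $W*A$ sorted in non-increasing order.
   Context: The adjacency matrix of $G$ is the $n\times n$ matrix $A=(a_{k\ell})$ with $a_{k\ell}=1$ if $(k,\ell)$ is an edge and $a_{k\ell}=0$ otherwise. The Schur product $W*A$ is the entrywise product, $(W*A)_{k\ell}=w_{k\ell}a_{k\ell}$. The chromatic number $\chi$ is the least $c$ for which there is a map $\Phi:\{1,\ldots,n\}\to\{1,\ldots,c\}$ with $\Phi(k)\ne\Phi(\ell)$ whenever $a_{k\ell}=1$. *)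

(* Defs.v *)
From HB Require Import structures.
From mathcomp Require Import all_boot all_order all_algebra.
From mathcomp Require Import complex.
From mathcomp Require Import all_classical all_reals.

Set Implicit Arguments.
Unset Strict Implicit.
Unset Printing Implicit Defensive.

Import Order.TTheory GRing.Theory Num.Theory.

Local Open Scope ring_scope.

Record graph (n : nat) := Graph {
  adj :> rel 'I_n;
  adj_sym : symmetric adj;
  adj_irr : irreflexive adj
}.

Definition colorable n (G : graph n) (c : nat) : bool :=
  [exists Phi : {ffun 'I_n -> 'I_c},
     [forall k, forall l, G k l ==> (Phi k != Phi l)]].

Lemma colorable_ex n (G : graph n) : exists c, colorable G c.
Proof.
exists n; apply/existsP; exists [ffun k => k].
apply/forallP => k; apply/forallP => l; apply/implyP => kl; rewrite !ffunE.
by apply: contraTneq kl => ->; rewrite adj_irr.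
Qed.

Definition chromatic_number n (G : graph n) : nat := ex_minn (colorable_ex G).

Section Spectral.
Variable R : realType.

Definition adjacency_mx n (G : graph n) : 'M[R[i]]_n :=
  \matrix_(k, l) (G k l)%:R.

Definition schur_prod n (W A : 'M[R[i]]_n) : 'M[R[i]]_n :=
  map2_mx (fun w a => w * a) W A.

(* The roots of the characteristic polynomial, repeated according to their
   multiplicity. *)
Definition eigenvalues n (M : 'M[R[i]]_n) : seq R[i] :=
  sval (closed_field_poly_normal (char_poly M)).

Lemma char_poly_eigenvalues n (M : 'M[R[i]]_n) :
  char_poly M = \prod_(z <- eigenvalues M) ('X - z%:P).
Proof.
rewrite /eigenvalues; case: closed_field_poly_normal => s /= {1}->.
by rewrite (monicP (char_poly_monic M)) scale1r.
Qed.

(* The i-th largest eigenvalue, 1 <= i <= n. It is only meant for self-adjoint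
   M, whose eigenvalues are real, so that taking real parts loses nothing. *)
Definition mu n (M : 'M[R[i]]_n) (i : nat) : R :=
  nth 0 (sort >=%R [seq complex.Re z | z <- eigenvalues M]) i.-1.

Definition eig_ratio n (M : 'M[R[i]]_n) (m : nat) : R :=
  (\sum_(1 <= i < m.+1) mu M i) / - (\sum_(1 <= i < m.+1) mu M (n - i + 1)).

(* The values over which the maximum is taken. The diagonal of
   schur_prod W A is zero, so for 1 <= m <= n - 1 the denominator vanishes only
   if schur_prod W A = 0; the ratio is then 0 / 0 = 0, while it is positive
   for every other W. *)
Definition eig_ratios n (G : graph n) : set R :=
  [set x | exists (W : 'M[R[i]]_n) (m : nat),
     [/\ W \is hermsymmx, (1 <= m <= n - 1)%N
       & x = eig_ratio (schur_prod W (adjacency_mx G)) m]].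

Definition is_max (S : set R) (x : R) : Prop := S x /\ ubound S x.

End Spectral.

Arguments adjacency_mx R {n} G.
Arguments eig_ratios R {n} G.

(* Main.v *)
Require Import Defs.
From mathcomp Require Import all_boot all_order all_algebra all_fingroup.
From mathcomp Require Import separable cyclic cyclotomic complex.
From mathcomp Require Import zify ring lra.
From mathcomp Require Import all_classical all_reals all_analysis.

(** Write B for a Hermitian matrix supported on the edges of G (these are
exactly the matrices W * A), and S_m(B) for the sum of its m largest
eigenvalues, [top_sum B m] below.

Everything goes through the Ky Fan principle: S_m(B) is the maximum of
tr (Q B) over the orthogonal projectors Q of rank m ([trace_orthoproj_le],
[top_sum_attained]). In an orthonormal eigenbasis tr (Q B) is an average of
eigenvalues with weights in [0, 1] of total m, and such a weighting is best
when it is concentrated on the m largest eigenvalues.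

Since G has no loops, tr B = 0, so minus the sum of the m smallest
eigenvalues is S_(n-m)(B), and the quotient to be bounded is
S_m(B) / S_(n-m)(B) ([eig_ratioE]). If B <> 0 and 0 < m < n then S_m(B) > 0:
the eigenvalues are not all equal to their mean 0 ([top_sum_mx_gt0]).

For the bound, let Phi be a colouring with c colours, z a primitive c-th root
of unity and U the diagonal unitary matrix with entries z ^ Phi(k). The (k, l)
entry of the sum of U^s B U^-s over s < c is B_kl times the sum over s < c of
(z ^ (Phi(k) - Phi(l))) ^ s, which vanishes unless Phi(k) = Phi(l); in that
case B_kl = 0. Hence B = - \sum_(0 < s < c) U^s B U^-s. If Q is an optimal
projector of rank m for B, each of the c - 1 terms contributes
- tr (Q U^s B U^-s) = tr ((1 - U^-s Q U^s) B) <= S_(n-m)(B), so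
S_m(B) <= (c - 1) S_(n-m)(B) ([top_sum_le_colours]).

The maximum is attained because, up to positive scaling, B ranges over a
compact set (the unit sphere of a real coordinate space, intersected with the
support condition), on which the quotient is continuous: by the Ky Fan
principle S_m is subadditive and bounded by the sum of the moduli of the
entries, hence Lipschitz. The finitely many values of m are then compared. *)

Set Implicit Arguments.
Unset Strict Implicit.
Unset Printing Implicit Defensive.

Import Order.TTheory GRing.Theory Num.Theory Num.Def.
Import numFieldNormedType.Exports.

Local Open Scope ring_scope.
Local Open Scope sesquilinear_scope.
Local Open Scope complex_scope.

(** * Weighted sums of a nonincreasing family *)

Lemma sum_ltn_indicator (R : pzSemiRingType) n m : (m <= n)%N ->
  \sum_(j < n) (j < m)%N%:R = m%:R :> R.
Proof.
move=> le_mn; rewrite -natr_sum; congr _%:R; rewrite -big_mkcond /= sum1_card.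
rewrite -[RHS](card_ord m) -!sum1_card.
by rewrite -(big_ord_widen _ (fun=> 1%N) le_mn).
Qed.

Section TopSums.
Variables (R : realFieldType) (n m : nat) (l : 'I_n -> R).
Hypothesis l_noninc : forall i j : 'I_n, (i <= j)%N -> l j <= l i.
Hypotheses (m_gt0 : (0 < m)%N) (le_mn : (m <= n)%N).

(** With t := l_(m-1) (0-based), the difference of the two sides is the sum of
(l_j - t) * ([j < m] - w_j), both sides having total weight m. Each term is
nonnegative: the two factors are >= 0 when j < m and <= 0 when j >= m. *)
Lemma weighted_sum_le_top (w : 'I_n -> R) :
    (forall j, 0 <= w j <= 1) -> \sum_j w j = m%:R ->
  \sum_j l j * w j <= \sum_(j < n | (j < m)%N) l j.
Proof.
move=> w01 sumw.
have ltm1 : (m.-1 < n)%N by rewrite prednK.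
pose t := l (Ordinal ltm1).
have sum1 := sum_ltn_indicator R le_mn.
rewrite [leRHS]big_mkcond -subr_ge0.
have -> : \sum_(j < n) (if (j < m)%N then l j else 0) - \sum_j l j * w j =
          \sum_j (l j - t) * ((j < m)%N%:R - w j).
  under [RHS]eq_bigr do rewrite mulrBl.
  rewrite sumrB -mulr_sumr sumrB sum1 sumw subrr mulr0 subr0 -sumrB.
  under [RHS]eq_bigr do rewrite mulrBr.
  by apply: eq_bigr => j _; congr (_ - _); case: ltnP; rewrite ?mulr1 ?mulr0.
apply: sumr_ge0 => j _; have /andP[w0 w1] := w01 j.
have [ltjm|lemj] := ltnP j m.
  by apply: mulr_ge0; rewrite subr_ge0 // l_noninc //= -ltnS prednK.
apply: mulr_le0; rewrite ?sub0r ?oppr_le0 // subr_le0 l_noninc //=.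
by rewrite (leq_trans _ lemj) ?leq_pred.
Qed.

(** The weights m/n + e * l_j have total m as the l_j sum to 0, lie in [0, 1]
for small e > 0 as 0 < m < n, and give the value e * \sum_j l_j ^+ 2 > 0. *)
Lemma top_sum_gt0 (j0 : 'I_n) : (m < n)%N -> \sum_j l j = 0 -> l j0 != 0 ->
  0 < \sum_(j < n | (j < m)%N) l j.
Proof.
move=> lt_mn suml l0.
have n_gt0 : 0 < n%:R :> R by rewrite ltr0n (leq_trans m_gt0).
pose s := \sum_j `|l j|.
have s_gt0 : 0 < s.
  by rewrite /s (bigD1 j0) //= ltr_pwDl ?normr_gt0 ?sumr_ge0.
have le_s j : `|l j| <= s.
  by rewrite /s (bigD1 j) //= lerDl sumr_ge0.
(* This choice makes |e * l_j| <= 1/n, the distance kept by m/n from 0 and 1. *)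
pose e := (n%:R * s)^-1; have e_gt0 : 0 < e by rewrite invr_gt0 mulr_gt0.
have el j : `|e * l j| <= n%:R^-1.
  by rewrite normrM gtr0_norm // /e invfM -mulrA ger_pMr ?invr_gt0 // mulrC
    ler_pdivrMr // mul1r.
apply: (@lt_le_trans _ _ (\sum_j l j * (m%:R / n%:R + e * l j))); last first.
  apply: weighted_sum_le_top => [j|]; last first.
    rewrite big_split /= sumr_const card_ord -mulr_sumr suml mulr0 addr0.
    by rewrite -[LHS]mulr_natr mulfVK // gt_eqF.
  have := el j; rewrite ler_norml => /andP[e1 e2].
  apply/andP; split.
    rewrite -(opprK (e * _)) subr_ge0 lerNl (le_trans _ e1) // lerN2.
    by rewrite ler_peMl ?invr_ge0 ?ler0n ?ler1n.
  apply: (le_trans (lerD (lexx _) e2)).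
  rewrite -[X in _ + X]mul1r -mulrDl ler_pdivrMr // mul1r.
  by rewrite natr1 ler_nat.
under eq_bigr do rewrite mulrDr [X in _ + X]mulrCA.
rewrite big_split /= -mulr_suml suml mul0r add0r -mulr_sumr.
rewrite mulr_gt0 // (bigD1 j0) //= ltr_pwDl // -?expr2 ?exprn_even_gt0 //=.
by apply: sumr_ge0 => j _; rewrite -expr2 sqr_ge0.
Qed.

End TopSums.

(** * Orthogonal projectors *)

Section Projectors.
Variable C : numClosedFieldType.

(** Prescribing the trace of a Hermitian idempotent prescribes its rank. *)
Definition orthoproj n (m : nat) (Q : 'M[C]_n) :=
  [/\ Q^t* = Q, Q *m Q = Q & \tr Q = m%:R].

Lemma adjoint_mul m n p (A : 'M[C]_(m, n)) (B : 'M[C]_(n, p)) :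
  (A *m B)^t* = B^t* *m A^t*.
Proof. by rewrite trmx_mul map_mxM. Qed.

Lemma unitarymx_mulVmx n (P : 'M[C]_n) : P \is unitarymx -> P^t* *m P = 1%:M.
Proof. by move=> Pu; rewrite -invmx_unitary // mulVmx ?unitarymx_unit. Qed.

Lemma orthoproj_conj n m (P Q : 'M[C]_n) : P \is unitarymx ->
  orthoproj m Q -> orthoproj m (P *m Q *m P^t*).
Proof.
move=> Pu [Qh QQ Qt]; split.
- by rewrite !adjoint_mul trmxCK Qh mulmxA.
- by rewrite !mulmxA -(mulmxA (P *m Q)) unitarymx_mulVmx // mulmx1
    -(mulmxA P Q Q) QQ.
- by rewrite mxtrace_mulC mulmxA unitarymx_mulVmx // mul1mx.
Qed.

Lemma orthoproj_compl n m (Q : 'M[C]_n) : (m <= n)%N ->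
  orthoproj m Q -> orthoproj (n - m) (1%:M - Q).
Proof.
move=> lemn [Qh QQ Qt]; split.
- by rewrite linearB /= map_mxB Qh trmx1 map_mx1.
- by rewrite mulmxBl mul1mx mulmxBr mulmx1 QQ subrr subr0.
- by rewrite linearB /= mxtrace1 Qt natrB.
Qed.

(** This is Q = Q Q^t* read on the diagonal; it bounds all the entries of Q. *)
Lemma orthoproj_diagE n m (Q : 'M[C]_n) j : orthoproj m Q ->
  Q j j = \sum_k `|Q j k| ^+ 2.
Proof.
case=> Qh QQ _; rewrite -{1}QQ mxE; apply: eq_bigr => k _.
by rewrite normCK; congr (_ * _); rewrite -{1}Qh !mxE.
Qed.

Lemma orthoproj_normsq_le n m (Q : 'M[C]_n) j k : orthoproj m Q ->
  `|Q j k| ^+ 2 <= Q j j.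
Proof.
move=> /orthoproj_diagE ->; rewrite (bigD1 k) //= lerDl.
by apply: sumr_ge0 => i _; rewrite exprn_ge0.
Qed.

(** For q := Q j j, the case k = j of the previous bound reads q ^+ 2 <= q. *)
Lemma orthoproj_diag_itv n m (Q : 'M[C]_n) j : orthoproj m Q ->
  0 <= Q j j <= 1.
Proof.
move=> Qp; have := orthoproj_normsq_le j j Qp.
have Q0 : 0 <= Q j j.
  by rewrite (orthoproj_diagE j Qp) sumr_ge0 // => i _; rewrite exprn_ge0.
rewrite Q0 ger0_norm //= expr2; move: Q0; rewrite le_eqVlt.
by case/predU1P=> [<- _|Q0]; rewrite ?ler01 // ger_pMr.
Qed.

Lemma orthoproj_norm_le1 n m (Q : 'M[C]_n) j k : orthoproj m Q ->
  `|Q j k| <= 1.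
Proof.
move=> Qp; rewrite -(@expr_le1 _ 2) //.
rewrite (le_trans (orthoproj_normsq_le j k Qp)) //.
by case/andP: (orthoproj_diag_itv j Qp).
Qed.

Lemma orthoproj_top n m : (m <= n)%N ->
  orthoproj m (diag_mx (\row_(j < n) ((j < m)%N%:R : C))).
Proof.
move=> lemn; split.
- rewrite tr_diag_mx map_diag_mx; congr diag_mx; apply/rowP => j.
  by rewrite !mxE rmorph_nat.
- rewrite mulmx_diag; congr diag_mx; apply/rowP => j.
  by rewrite !mxE -natrM mulnb andbb.
- rewrite mxtrace_diag; under eq_bigr do rewrite mxE.
  exact: sum_ltn_indicator.
Qed.

End Projectors.

(** * The Ky Fan principle *)

Lemma char_poly_conj (F : fieldType) n (P D : 'M[F]_n) : P \in unitmx ->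
  char_poly (invmx P *m D *m P) = char_poly D.
Proof.
move=> Pu; rewrite /char_poly.
have PP : map_mx polyC (invmx P) *m map_mx polyC P = 1%:M.
  by rewrite -map_mxM mulVmx // map_mx1.
have -> : char_poly_mx (invmx P *m D *m P) =
   map_mx polyC (invmx P) *m char_poly_mx D *m map_mx polyC P.
  rewrite /char_poly_mx mulmxBr mulmxBl !map_mxM; congr (_ - _).
  by rewrite scalar_mxC -mulmxA PP mulmx1.
by rewrite !det_mulmx mulrAC -det_mulmx PP det1 mul1r.
Qed.

Section KyFan.
Variable R : realType.
Local Notation C := R[i].
Implicit Types (n m : nat).

Definition top_sum n (M : 'M[C]_n) m : R := \sum_(j < n | (j < m)%N) mu M j.+1.

(** The spectral theorem with the eigenvalues listed in nonincreasing order: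
the roots of the characteristic polynomial are the diagonal entries of any
diagonalisation, so that sorting them amounts to permuting an eigenbasis. *)
Lemma spectral_mu n (B : 'M[C]_n) : B \is hermsymmx ->
  exists2 P : 'M[C]_n, P \is unitarymx &
    B = P^t* *m diag_mx (\row_j (mu B j.+1)%:C) *m P.
Proof.
move=> Bh; pose P := spectralmx B; pose d := spectral_diag B.
have Pu : P \is unitarymx := spectral_unitarymx B.
have BE : B = invmx P *m diag_mx d *m P.
  exact/orthomx_spectralP/hermitian_normalmx.
have d_real j : (complex.Re (d 0 j))%:C = d 0 j.
  by apply: RRe_real; exact: (mxOverP (hermitian_spectral_diag_real Bh)).
have eigB : perm_eq (eigenvalues B) [seq d 0 j | j <- enum 'I_n].
  apply: prod_XsubC_eq; rewrite -char_poly_eigenvalues BE char_poly_conj.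
    rewrite char_poly_trig ?diag_mx_is_trig //= big_map big_enum /=.
    by apply: eq_bigr => j _; rewrite mxE eqxx.
  exact: unitarymx_unit.
pose s := sort >=%R [seq complex.Re z | z <- eigenvalues B].
have /tuple_permP[p sE] : perm_eq s [tuple complex.Re (d 0 j) | j < n].
  rewrite perm_sort /= (perm_trans (perm_map _ eigB)) //.
  by rewrite -map_comp -val_ord_tuple perm_refl.
have muE (j : 'I_n) : (mu B j.+1)%:C = d 0 (p j).
  rewrite /mu -/s sE /= (nth_map j) ?size_enum_ord // nth_ord_enum.
  by rewrite tnth_mktuple d_real.
exists (perm_mx p *m P).
  rewrite mul_unitarymx //; apply/unitarymxP.
  by rewrite tr_perm_mx map_perm_mx -perm_mxM mulgV perm_mx1.
rewrite [LHS]BE adjoint_mul -invmx_unitary // !mulmxA; congr (_ *m _).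
rewrite -!mulmxA; congr (_ *m _).
rewrite tr_perm_mx map_perm_mx -row_permE mul_diag_mx.
by apply/matrixP => i j; rewrite !mxE muE permKV mulr_natr.
Qed.

Lemma mu_noninc n (B : 'M[C]_n) (i j : 'I_n) : (i <= j)%N ->
  mu B j.+1 <= mu B i.+1.
Proof.
move=> leij; pose s := sort >=%R [seq complex.Re z | z <- eigenvalues B].
have sz : size s = n.
  rewrite size_sort size_map; apply: succn_inj; rewrite -(size_char_poly B).
  by rewrite char_poly_eigenvalues size_prod_XsubC.
have s_sorted : sorted >=%R s.
  by apply: sort_sorted => x y; rewrite /= orbC le_total.
have ge_trans : transitive (>=%R : rel R).
  by move=> x y z /= yx zy; exact: le_trans zy yx.
have ge_refl : reflexive (>=%R : rel R) by move=> x /=.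
have := sorted_leq_nth ge_trans ge_refl 0 s_sorted.
by move/(_ i j); rewrite !inE sz !ltn_ord; apply.
Qed.

Lemma mxtrace_mu n (B : 'M[C]_n) : B \is hermsymmx ->
  \tr B = (\sum_(j < n) mu B j.+1)%:C.
Proof.
case/spectral_mu => P Pu BE.
rewrite {1}BE mxtrace_mulC mulmxA (unitarymxP Pu) mul1mx mxtrace_diag.
by rewrite rmorph_sum; apply: eq_bigr => j _; rewrite mxE.
Qed.

(** In an eigenbasis of B, tr (Q B) is the sum of the eigenvalues weighted by
the diagonal entries of a projector of trace m. Comparison is in the order of
the complex numbers, so it also says that the trace is real. *)
Lemma trace_orthoproj_le n m (B Q : 'M[C]_n) : B \is hermsymmx ->
  (0 < m <= n)%N -> orthoproj m Q -> \tr (Q *m B) <= (top_sum B m)%:C.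
Proof.
move=> Bh /andP[m_gt0 lemn] Qp; have [P Pu BE] := spectral_mu Bh.
have Q'p := orthoproj_conj Pu Qp; set Q' := P *m Q *m P^t* in Q'p.
have Q'01 j := orthoproj_diag_itv j Q'p.
have Q'real j : (complex.Re (Q' j j))%:C = Q' j j.
  by apply: RRe_real; rewrite ger0_real //; case/andP: (Q'01 j).
have -> : \tr (Q *m B) = (\sum_(j < n) mu B j.+1 * complex.Re (Q' j j))%:C.
  rewrite {1}BE mulmxA mxtrace_mulC !mulmxA mxtrace_mulC.
  rewrite -/Q' mul_diag_mx rmorph_sum; apply: eq_bigr => j _.
  by rewrite [LHS]mxE mxE -[in LHS]Q'real -rmorphM.
rewrite lecR; apply: weighted_sum_le_top => //; first exact: mu_noninc.
  by move=> j; rewrite -!lecR Q'real.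
have [_ _ trQ'] := Q'p.
apply: complexI; rewrite rmorph_sum rmorph_nat -trQ'.
by apply: eq_bigr => j _; rewrite -Q'real.
Qed.

(** The projector onto the span of eigenvectors of the m largest eigenvalues. *)
Lemma top_sum_attained n m (B : 'M[C]_n) : B \is hermsymmx -> (m <= n)%N ->
  exists2 Q, orthoproj m Q & \tr (Q *m B) = (top_sum B m)%:C.
Proof.
move=> Bh lemn; have [P Pu BE] := spectral_mu Bh.
have P'u : P^t* \is unitarymx by rewrite trmxC_unitary.
exists (P^t* *m diag_mx (\row_(j < n) (j < m)%N%:R) *m P).
  by have := orthoproj_conj P'u (orthoproj_top _ lemn); rewrite trmxCK.
rewrite {1}BE !mulmxA mxtrace_mulC !mulmxA (unitarymxP Pu) mul1mx.
rewrite -(mulmxA _ P) (unitarymxP Pu) mulmx1 mulmx_diag mxtrace_diag.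
rewrite /top_sum rmorph_sum [RHS]big_mkcond; apply: eq_bigr => j _.
by rewrite !mxE; case: ifP; rewrite ?mul1r ?mul0r.
Qed.

Lemma mu_eq0 n (B : 'M[C]_n) : B \is hermsymmx ->
  (forall j : 'I_n, mu B j.+1 = 0) -> B = 0.
Proof.
case/spectral_mu => P Pu BE mu0.
have D0 : \row_(j < n) (mu B j.+1)%:C = 0 by apply/rowP => j; rewrite !mxE mu0.
by rewrite BE D0 linear0 mulmx0 mul0mx.
Qed.

Lemma top_sum_mx_gt0 n m (B : 'M[C]_n) : B \is hermsymmx -> \tr B = 0 ->
  B != 0 -> (0 < m < n)%N -> 0 < top_sum B m.
Proof.
move=> Bh trB B0 /andP[m0 ltmn].
have [/existsP[j muj]|] := boolP [exists j : 'I_n, mu B j.+1 != 0].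
  apply: (top_sum_gt0 _ m0 (ltnW ltmn) ltmn _ muj); first exact: mu_noninc.
  by apply: complexI; rewrite -mxtrace_mu.
rewrite negb_exists => /forallP mu0; case/negP: B0; apply/eqP/mu_eq0 => // j.
by have := mu0 j; rewrite negbK => /eqP.
Qed.

(** The m smallest and the n - m largest eigenvalues together sum to tr B = 0. *)
Lemma eig_ratioE n m (B : 'M[C]_n) : B \is hermsymmx -> \tr B = 0 ->
  (0 < m < n)%N -> eig_ratio B m = top_sum B m / top_sum B (n - m).
Proof.
move=> Bh trB /andP[m0 ltmn]; rewrite /eig_ratio.
have topE k : (k <= n)%N -> top_sum B k = \sum_(1 <= i < k.+1) mu B i.
  move=> lekn; rewrite big_add1 big_mkord /top_sum.
  by rewrite -(big_ord_widen _ (fun j => mu B j.+1)).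
congr (_ / _); first by rewrite topE // ltnW.
apply/eqP; rewrite -subr_eq0 -opprD oppr_eq0; apply/eqP.
rewrite topE ?leq_subr //.
have tot : \sum_(1 <= i < n.+1) mu B i = 0.
  rewrite big_add1 big_mkord; apply: complexI.
  by rewrite -mxtrace_mu.
rewrite -[RHS]tot [RHS](@big_cat_nat _ _ _ (n - m).+1) //= ?ltnS ?leq_subr //.
rewrite [RHS]addrC.
congr (_ + _); rewrite [LHS]big_nat_rev /= -[(n - m).+1]add1n big_addn.
have -> : (n.+1 - (n - m) = m.+1)%N by lia.
by rewrite !big_nat; apply: eq_bigr => i /andP[i1 im]; congr mu; lia.
Qed.

End KyFan.

(** * Conjugation by roots of unity indexed by colours *)

Section ColourConjugation.
Variable C : numClosedFieldType.

(** 'X^n - 1 splits with distinct roots in characteristic 0, and a group of n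
roots of unity in a field is cyclic. *)
Lemma prim_root_exists n : (0 < n)%N -> exists z : C, n.-primitive_root z.
Proof.
move=> n_gt0; pose p : {poly C} := 'X^n - 1.
have [r Dp] := closed_field_poly_normal p.
rewrite (monicP _) ?monicXnsubC // scale1r in Dp.
have rn1 : all n.-unity_root r.
  by apply/allP=> z; rewrite -root_prod_XsubC -Dp.
have sz_r : (n < (size r).+1)%N.
  by rewrite -(size_prod_XsubC r id) -Dp size_XnsubC.
have [|z] := hasP (has_prim_root n_gt0 rn1 _ sz_r); last by exists z.
by rewrite -separable_prod_XsubC -Dp separable_Xn_sub_1 // pnatr_eq0 -lt0n.
Qed.

Variables (n c : nat) (Phi : 'I_n -> 'I_c) (z : C).
Hypothesis z_prim : c.-primitive_root z.

Definition colour_mx (s : nat) : 'M[C]_n := diag_mx (\row_k z ^+ (s * Phi k)).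

Lemma colour_mx0 : colour_mx 0 = 1%:M.
Proof.
rewrite /colour_mx -[RHS]diag_const_mx; congr diag_mx.
by apply/rowP => k; rewrite !mxE.
Qed.

Lemma prim_root_conj i : conjC (z ^+ i) = (z ^+ i)^-1.
Proof.
have z1 : `|z| = 1.
  apply/eqP; rewrite -(@pexpr_eq1 _ _ c) ?normr_ge0 ?(prim_order_gt0 z_prim) //.
  by rewrite -normrX (prim_expr_order z_prim) normr1.
by rewrite invC_norm normrX z1 !expr1n invr1 mul1r.
Qed.

Lemma prim_root_neq0 i : z ^+ i != 0.
Proof.
by rewrite expf_neq0 // (prim_root_eq0 z_prim) -lt0n (prim_order_gt0 z_prim).
Qed.

Lemma colour_mx_unitary s : colour_mx s \is unitarymx.
Proof.
apply/unitarymxP; rewrite tr_diag_mx map_diag_mx mulmx_diag -[RHS]diag_const_mx.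
congr diag_mx; apply/rowP => k.
by rewrite !mxE /= prim_root_conj divff // prim_root_neq0.
Qed.

(** The (k, l) entry is B k l times a geometric sum of ratio
z ^+ Phi k / z ^+ Phi l, a c-th root of unity different from 1 as soon as
Phi k <> Phi l. *)
Lemma sum_colour_conj (B : 'M[C]_n) :
    (forall k l, Phi k = Phi l -> B k l = 0) ->
  \sum_(s < c) colour_mx s *m B *m (colour_mx s)^t* = 0.
Proof.
move=> B0; apply/matrixP => k l; rewrite summxE mxE.
pose x := z ^+ Phi k / z ^+ Phi l.
transitivity (\sum_(s < c) B k l * x ^+ s).
  apply: eq_bigr => s _.
  rewrite tr_diag_mx map_diag_mx mul_mx_diag mul_diag_mx !mxE /=.
  by rewrite prim_root_conj expr_div_n -!exprM mulnC (mulnC s) mulrAC mulrC.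
rewrite -mulr_sumr.
have [/B0 ->|Pkl] := eqVneq (Phi k) (Phi l); first by rewrite mul0r.
have x1 : x - 1 != 0.
  rewrite subr_eq0 /x -(inj_eq (mulIf (prim_root_neq0 (Phi l)))).
  rewrite divfK ?prim_root_neq0 // mul1r (eq_prim_root_expr z_prim).
  by rewrite !modn_small.
have -> : \sum_(s < c) x ^+ s = 0; last by rewrite mulr0.
apply: (mulfI x1); rewrite mulr0 -subrX1 /x expr_div_n -!exprM.
by rewrite !(mulnC _ c) !exprM (prim_expr_order z_prim) !expr1n divr1 subrr.
Qed.

End ColourConjugation.

Section ColourBound.
Variable R : realType.
Local Notation C := R[i].

(** Isolating the term s = 0 of [sum_colour_conj] writes B as minus a sum of c
unitary conjugates of B. Tested on an optimal projector of trace m, each of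
them is B tested on a complementary projector of trace n - m, by tr B = 0. *)
Lemma top_sum_le_colours n c m (B : 'M[C]_n) (Phi : 'I_n -> 'I_c.+1) :
    B \is hermsymmx -> (forall k l, Phi k = Phi l -> B k l = 0) ->
    (0 < m < n)%N ->
  top_sum B m <= c%:R * top_sum B (n - m).
Proof.
move=> Bh B0 /andP[m0 ltmn].
have trB : \tr B = 0 by apply: big1 => k _; exact: B0.
have [Q Qp trQB] := top_sum_attained Bh (ltnW ltmn).
have [z z_prim] := prim_root_exists C (ltn0Sn c).
pose U s := colour_mx Phi z s.
have Uu s : U s \is unitarymx by exact: colour_mx_unitary.
have := sum_colour_conj z_prim B0.
rewrite big_ord_recl /= colour_mx0 mul1mx trmx1 map_mx1 mulmx1.
move/eqP; rewrite addr_eq0 => /eqP BE.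
rewrite -lecR -trQB [in leLHS]BE mulmxN mulmx_sumr linearN /=.
rewrite (linear_sum mxtrace) -sumrN /=.
rewrite rmorphM rmorph_nat mulr_natl -[X in _ *+ X](card_ord c) -sumr_const.
apply: ler_sum => s _; rewrite -/(U (bump 0 s)); set V := U _.
have Vu : V^t* \is unitarymx by rewrite trmxC_unitary; exact: Uu.
have Q'p := orthoproj_compl (ltnW ltmn) (orthoproj_conj Vu Qp).
have nm : (0 < n - m <= n)%N by rewrite subn_gt0 ltmn leq_subr.
apply: le_trans (trace_orthoproj_le Bh nm Q'p).
rewrite mulmxBl mul1mx linearB /= trB sub0r trmxCK -/V.
by rewrite -!mulmxA [in leRHS]mxtrace_mulC !mulmxA.
Qed.

Lemma hermsymmx0 n : (0 : 'M[C]_n) \is hermsymmx.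
Proof. by apply/is_hermitianmxP; rewrite trmx0 map_mx0 scaler0. Qed.

Lemma top_sum0 n m : (m <= n)%N -> top_sum (0 : 'M[C]_n) m = 0.
Proof.
move=> lemn; have [Q _] := top_sum_attained (hermsymmx0 n) lemn.
by rewrite mulmx0 linear0 => /esym/complexI.
Qed.

End ColourBound.

(** * Regularity of the sums of largest eigenvalues *)

Section Compactness.
Variable R : realType.
Local Notation C := R[i].

Lemma hermsymmxD n (A B : 'M[C]_n) :
  A \is hermsymmx -> B \is hermsymmx -> A + B \is hermsymmx.
Proof.
move=> /is_hermitianmxP Ah /is_hermitianmxP Bh; apply/is_hermitianmxP.
by rewrite expr0 scale1r linearD map_mxD {1}Ah {1}Bh !expr0 !scale1r.
Qed.

Lemma hermsymmxZ n (t : R) (A : 'M[C]_n) :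
  A \is hermsymmx -> t%:C *: A \is hermsymmx.
Proof.
move=> /is_hermitianmxP Ah; apply/is_hermitianmxP.
rewrite expr0 scale1r linearZ map_mxZ /= {1}Ah expr0 scale1r.
by rewrite conj_Creal // complex_real.
Qed.

(** A projector that is optimal for A + B is admissible for A and for B. *)
Lemma top_sumD_le n m (A B : 'M[C]_n) :
    A \is hermsymmx -> B \is hermsymmx -> (0 < m <= n)%N ->
  top_sum (A + B) m <= top_sum A m + top_sum B m.
Proof.
move=> Ah Bh lemn; have /andP[_ le_mn] := lemn.
have [Q Qp trQ] := top_sum_attained (hermsymmxD Ah Bh) le_mn.
rewrite -lecR -trQ mulmxDr linearD rmorphD /=.
by apply: lerD; apply: trace_orthoproj_le.
Qed.

Lemma top_sumZ_le n m (t : R) (A : 'M[C]_n) : 0 <= t ->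
    A \is hermsymmx -> (0 < m <= n)%N ->
  top_sum (t%:C *: A) m <= t * top_sum A m.
Proof.
move=> t0 Ah lemn; have /andP[_ le_mn] := lemn.
have [Q Qp trQ] := top_sum_attained (hermsymmxZ t Ah) le_mn.
rewrite -lecR -trQ -scalemxAr linearZ rmorphM /=.
by apply: ler_wpM2l; rewrite ?ler0c //; apply: trace_orthoproj_le.
Qed.

Lemma top_sumZ n m (t : R) (A : 'M[C]_n) : 0 < t ->
    A \is hermsymmx -> (0 < m <= n)%N ->
  top_sum (t%:C *: A) m = t * top_sum A m.
Proof.
move=> t0 Ah lemn; apply/eqP; rewrite eq_le (top_sumZ_le (ltW t0)) //=.
rewrite -ler_pdivlMl //; have := hermsymmxZ t Ah => tAh.
have := @top_sumZ_le n m t^-1 _ _ tAh lemn; rewrite invr_ge0 (ltW t0) scalerA.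
by rewrite -rmorphM mulVf ?gt_eqF // scale1r; apply.
Qed.

(** The entries of an optimal projector have modulus at most 1. *)
Lemma top_sum_le_norm n m (A : 'M[C]_n) :
    A \is hermsymmx -> (m <= n)%N ->
  (top_sum A m)%:C <= \sum_k \sum_l `|A k l|.
Proof.
move=> Ah lemn; have [Q Qp trQA] := top_sum_attained Ah lemn.
have trE : \tr (Q *m A) = \sum_l \sum_k Q l k * A k l.
  by apply: eq_bigr => l _; rewrite mxE.
rewrite (le_trans (real_ler_norm _)) ?complex_real // -trQA trE.
rewrite exchange_big (le_trans (ler_norm_sum _ _ _)) //.
apply: ler_sum => k _; rewrite (le_trans (ler_norm_sum _ _ _)) //.
apply: ler_sum => l _; rewrite normrM ler_piMl //.
exact: orthoproj_norm_le1 Qp.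
Qed.

(** An arbitrary real matrix X, flattened to a row vector, encodes the
Hermitian matrix with real part X + X^T and imaginary part X - X^T. This is a
real-linear bijection, which gives the Hermitian matrices n * n free real
coordinates, whose unit sphere for the sup norm is compact. *)
Definition herm_of n (x : 'rV[R]_(n * n)) : 'M[C]_n :=
  \matrix_(k, l) ((vec_mx x k l + vec_mx x l k) +i*
                  (vec_mx x k l - vec_mx x l k)).

Lemma conjC_complex (a b : R) : conjC (a +i* b : C) = a -i* b.
Proof. by []. Qed.

Lemma herm_of_herm n (x : 'rV[R]_(n * n)) : herm_of x \is hermsymmx.
Proof.
apply/is_hermitianmxP; rewrite expr0 scale1r; apply/matrixP => k l.
by rewrite !mxE /= conjC_complex opprB addrC.
Qed.

Lemma herm_ofB n (x y : 'rV[R]_(n * n)) :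
  herm_of (x - y) = herm_of x - herm_of y.
Proof.
apply/matrixP => k l; rewrite !mxE; simpc.
by congr (_ +i* _); ring.
Qed.

Lemma herm_ofZ n (t : R) (x : 'rV[R]_(n * n)) :
  herm_of (t *: x) = t%:C *: herm_of x.
Proof.
apply/matrixP => k l; rewrite !mxE; simpc.
by congr (_ +i* _); ring.
Qed.

Definition coords n (B : 'M[C]_n) : 'rV[R]_(n * n) :=
  mxvec (\matrix_(k, l) ((complex.Re (B k l) + complex.Im (B k l)) / 2)).

Lemma herm_ofK n (B : 'M[C]_n) : B \is hermsymmx -> herm_of (coords B) = B.
Proof.
move=> /is_hermitianmxP; rewrite expr0 scale1r => Bh.
apply/matrixP => k l; have /(congr1 (fun M : 'M[C]_n => M l k)) := Bh.
rewrite [herm_of _ _ _]mxE mxvecK !mxE /=.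
case: (B k l) (B l k) => [a b] [c d]; rewrite conjC_complex /= => -[-> ->].
by congr (_ +i* _); field.
Qed.

Lemma herm_of_inj0 n (x : 'rV[R]_(n * n)) : herm_of x = 0 -> x = 0.
Proof.
move=> H0; rewrite -[x]vec_mxK; apply/eqP; rewrite -[0](linear0 mxvec).
rewrite (inj_eq (can_inj mxvecK)).
apply/eqP/matrixP => k l; rewrite [RHS]mxE.
have := congr1 (fun M : 'M[C]_n => M k l) H0; rewrite /= mxE [RHS]mxE => -[].
by lra.
Qed.

Lemma coord_le_norm N (x : 'rV[R]_N) i : `|x 0 i| <= `|x|.
Proof.
rewrite [leRHS]/normr /= mx_normrE; apply/bigmax_geP; right => /=.
by exists (0, i).
Qed.

(** Both parts of an entry are at most 2 * `|x|, and sqrt 8 <= 4. *)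
Lemma herm_of_entry_le n (x : 'rV[R]_(n * n)) k l :
  `|herm_of x k l| <= (4 * `|x|)%:C.
Proof.
have X i j : `|vec_mx x i j| <= `|x|.
  by have := coord_le_norm x (mxvec_index i j); rewrite -{1}[x]vec_mxK mxvecE.
rewrite mxE normc_def lecR /=.
have := X k l; have := X l k; move: (vec_mx x k l) (vec_mx x l k) => a b.
rewrite !ler_norml => /andP[b1 b2] /andP[a1 a2].
rewrite -[leRHS]ger0_norm ?mulr_ge0 // -sqrtr_sqr ler_sqrt ?sqr_ge0 //.
by nra.
Qed.

(** Subadditivity bounds the difference of the top sums at x and y by the top
sum at x - y, hence by the sum of n * n entries of modulus <= 4 * `|x - y|. *)
Lemma top_sum_herm_of_lip n m (x y : 'rV[R]_(n * n)) : (0 < m <= n)%N ->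
  top_sum (herm_of x) m - top_sum (herm_of y) m <= (n * n * 4)%:R * `|x - y|.
Proof.
move=> lemn; have /andP[_ le_mn] := lemn.
rewrite lerBlDl.
have -> : herm_of x = herm_of y + herm_of (x - y).
  by rewrite herm_ofB addrC subrK.
apply: le_trans (top_sumD_le (herm_of_herm _) (herm_of_herm _) lemn) _.
rewrite lerD2l -lecR.
apply: le_trans (top_sum_le_norm (herm_of_herm _) le_mn) _.
have -> : ((n * n * 4)%:R * `|x - y|)%:C =
    \sum_(k < n) \sum_(l < n) (4 * `|x - y|)%:C :> C.
  rewrite !sumr_const card_ord -mulrnA -rmorphMn /=; congr (_ %:C).
  by rewrite natrM -mulrA -[RHS]mulr_natl.
by apply: ler_sum => k _; apply: ler_sum => l _; exact: herm_of_entry_le.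
Qed.

Local Open Scope classical_set_scope.

(** The one-sided bound suffices: exchanging x and y gives the other one. *)
Lemma lipschitz_continuous (V : normedModType R) (f : V -> R) (L : R) :
  0 <= L -> (forall x y, f x - f y <= L * `|x - y|) -> continuous f.
Proof.
move=> L0 lip x; have L1 : 0 < L + 1 by rewrite ltr_wpDl.
apply/cvgrPdist_le => e e0; near=> y.
have xy : `|x - y| <= e / (L + 1).
  near: y; apply: (@cvgr_dist_le _ _ _ _ _ id x); last exact: divr_gt0.
  exact: cvg_id.
apply: (@le_trans _ _ (L * `|x - y|)); last first.
  apply: (@le_trans _ _ ((L + 1) * `|x - y|)).
    by rewrite ler_wpM2r // lerDl.
  by rewrite mulrC -ler_pdivlMr.
have := lip y x; rewrite distrC => lipyx.
by rewrite ler_norml lerNl opprB lipyx lip.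
Unshelve. all: by end_near. Qed.

Lemma top_sum_herm_of_continuous n m : (0 < m <= n)%N ->
  continuous (fun x : 'rV[R]_(n * n) => top_sum (herm_of x) m).
Proof.
move=> lemn; apply: (@lipschitz_continuous _ _ (n * n * 4)%:R).
  exact: ler0n.
by move=> x y; exact: top_sum_herm_of_lip.
Qed.

(** * Attaining the maximum for a fixed number of eigenvalues *)

Variables (n : nat) (G : graph n).

Definition supported (B : 'M[C]_n) := forall k l, ~~ G k l -> B k l = 0.

Definition unit_coords : set 'rV[R]_(n * n) :=
  [set x | `|x| = 1 /\ supported (herm_of x)].

Lemma supported_coords (x : 'rV[R]_(n * n)) : supported (herm_of x) ->
  forall k l, ~~ G k l -> x 0 (mxvec_index k l) = 0.
Proof.
by move=> xs k l /xs; rewrite !mxE => -[]; lra.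
Qed.

(** In coordinates, the support condition says that some coordinates vanish.
So the set is the unit sphere, which is closed, inside a product of segments
[-1, 1] and points {0}, which is compact. *)
Lemma unit_coords_compact : compact unit_coords.
Proof.
pose Gv : 'rV[bool]_(n * n) := mxvec (\matrix_(k, l) G k l).
pose I i : set R := if Gv 0 i then `[-1, 1] else [set 0].
pose box : set 'rV[R]_(n * n) := [set x | forall i, I i (x ord0 i)].
pose sphere : set 'rV[R]_(n * n) := normr @^-1` [set 1 : R].
have -> : unit_coords = box `&` sphere.
  apply/seteqP; split=> x /= [].
    move=> x1 xs; split=> // i; rewrite /I; case: ifPn => [_|].
      by rewrite /= in_itv /= -ler_norml -x1 coord_le_norm.
    case/mxvec_indexP: i => k l; rewrite /Gv mxvecE mxE => Gkl.
    exact: supported_coords.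
  move=> xI x1; split=> // k l Gkl.
  have x0 i j : ~~ G i j -> x 0 (mxvec_index i j) = 0.
    move=> Gij; have := xI (mxvec_index i j).
    by rewrite /I /Gv mxvecE mxE (negPf Gij).
  by rewrite !mxE !x0 // 1?adj_sym // addr0 subrr.
apply: compact_closedI.
  apply: (@rV_compact R _ I) => i; rewrite /I; case: ifP => _.
    exact: segment_compact.
  exact: compact_set1.
apply: closed_comp => [x _|]; first exact: norm_continuous.
exact: closed_eq.
Qed.

Lemma supported_trace0 B : supported B -> \tr B = 0.
Proof. by move=> Bs; apply: big1 => k _; rewrite Bs // adj_irr. Qed.

Lemma unit_coords_neq0 x : unit_coords x -> herm_of x != 0.
Proof.
move=> [x1 _]; apply/eqP => /herm_of_inj0 x0.
by move: x1; rewrite x0 normr0 => /esym/eqP; rewrite oner_eq0.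
Qed.

Lemma unit_coords_scale B : B \is hermsymmx -> supported B -> B != 0 ->
  exists2 x, unit_coords x &
    exists2 t : R, 0 < t & herm_of x = t%:C *: B.
Proof.
move=> Bh Bs B0; pose y := coords B; have yB : herm_of y = B := herm_ofK Bh.
have y0 : 0 < `|y|.
  rewrite normr_gt0; apply: contraNneq B0 => y0.
  by rewrite -yB y0 -[0](subrr 0) herm_ofB subrr.
have xB : herm_of (`|y|^-1 *: y) = `|y|^-1%:C *: B by rewrite herm_ofZ yB.
exists (`|y|^-1 *: y); last by exists `|y|^-1; rewrite ?invr_gt0.
split; first by rewrite normrZ gtr0_norm ?invr_gt0 // mulVf ?gt_eqF.
by move=> k l Gkl; rewrite xB mxE Bs // mulr0.
Qed.

Lemma eig_ratioZ (t : R) (B : 'M[C]_n) m : 0 < t -> B \is hermsymmx ->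
  supported B -> (0 < m < n)%N -> eig_ratio (t%:C *: B) m = eig_ratio B m.
Proof.
move=> t0 Bh Bs m0n; have trB := supported_trace0 Bs.
have [mn nmn] : (0 < m <= n)%N /\ (0 < n - m <= n)%N by lia.
have trtB : \tr (t%:C *: B) = 0 by rewrite linearZ /= trB mulr0.
rewrite (eig_ratioE Bh trB m0n) (eig_ratioE (hermsymmxZ t Bh) trtB m0n).
rewrite (top_sumZ t0 Bh mn) (top_sumZ t0 Bh nmn).
by rewrite -mulf_div divff ?mul1r ?gt_eqF.
Qed.

(** The quotient is invariant under positive scaling of B, so B can be moved to
the compact set [unit_coords], where the denominator does not vanish. *)
Lemma eig_ratio_max m : (0 < m < n)%N -> unit_coords !=set0 ->
  exists2 x, unit_coords x & forall B, B \is hermsymmx -> supported B ->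
    B != 0 -> eig_ratio B m <= eig_ratio (herm_of x) m.
Proof.
move=> m0n K0; have /andP[m0 ltmn] := m0n.
pose f (x : 'rV[R]_(n * n)) :=
  top_sum (herm_of x) m / top_sum (herm_of x) (n - m).
have fE x : unit_coords x -> eig_ratio (herm_of x) m = f x.
  by case=> _ xs; exact: eig_ratioE (herm_of_herm x) (supported_trace0 xs) m0n.
have [|x xK xmax] := @compact_EVT_max _ _ f _ K0 unit_coords_compact.
  apply: continuous_in_subspaceT => x /set_mem xK.
  have [_ xs] := xK.
  have [mn nmn] : (0 < m <= n)%N /\ (0 < n - m <= n)%N by lia.
  have nm0n : (0 < n - m < n)%N by lia.
  have den0 : top_sum (herm_of x) (n - m) != 0.
    rewrite gt_eqF //; apply: (top_sum_mx_gt0 (herm_of_herm x)) nm0n.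
      exact: supported_trace0.
    exact: unit_coords_neq0.
  have num_cont := @top_sum_herm_of_continuous n m mn x.
  have den_cont := @top_sum_herm_of_continuous n (n - m) nmn x.
  exact: (cvgM num_cont (cvgV den0 den_cont)).
move/set_mem: xK => xK; exists x; first exact: xK.
move=> B Bh Bs B0.
have [y yK [t t0 yB]] := unit_coords_scale Bh Bs B0.
rewrite -(eig_ratioZ t0 Bh Bs m0n) -yB (fE _ yK) (fE _ xK).
by apply: xmax; exact: mem_set.
Qed.

End Compactness.

(** * The bound and its sharpest instance *)

Section Bound.
Variables (R : realType) (n : nat) (G : graph n).
Local Notation C := R[i].

Lemma schur_supported (W : 'M[C]_n) :
  supported G (schur_prod W (adjacency_mx R G)).
Proof. by move=> k l Gkl; rewrite !mxE (negPf Gkl) mulr0. Qed.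

Lemma schur_hermsymmx (W : 'M[C]_n) : W \is hermsymmx ->
  schur_prod W (adjacency_mx R G) \is hermsymmx.
Proof.
move=> /is_hermitianmxP; rewrite expr0 scale1r => Wh.
apply/is_hermitianmxP; rewrite expr0 scale1r; apply/matrixP => k l.
have /(congr1 (fun M : 'M[C]_n => M k l)) := Wh.
by rewrite !mxE => ->; rewrite rmorphM rmorph_nat adj_sym.
Qed.

Lemma schur_supported_id (B : 'M[C]_n) : supported G B ->
  schur_prod B (adjacency_mx R G) = B.
Proof.
move=> Bs; apply/matrixP => k l; rewrite !mxE.
by case: (boolP (G k l)) => [_|/Bs ->]; rewrite ?mulr1 ?mul0r.
Qed.

Lemma eig_ratio0 m : (0 < m < n)%N -> eig_ratio (0 : 'M[C]_n) m = 0.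
Proof.
move=> m0n; have mn : (m <= n)%N by lia.
rewrite (eig_ratioE (hermsymmx0 R n) (linear0 mxtrace) m0n).
by rewrite (top_sum0 _ mn) mul0r.
Qed.

Lemma eig_ratio_le_colours c m (B : 'M[C]_n) : colorable G c.+1 ->
    B \is hermsymmx -> supported G B -> (0 < m < n)%N ->
  eig_ratio B m <= c%:R.
Proof.
move=> /existsP[Phi /forallP PhiP] Bh Bs m0n.
have [->|B0] := eqVneq B 0; first by rewrite (eig_ratio0 m0n) ler0n.
have nm0n : (0 < n - m < n)%N by lia.
have trB := supported_trace0 Bs.
rewrite (eig_ratioE Bh trB m0n) ler_pdivrMr; last exact: top_sum_mx_gt0 nm0n.
apply: (@top_sum_le_colours _ _ _ _ _ Phi) => // k l Pkl; apply: Bs.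
apply/negP => Gkl; have /forallP/(_ l) := PhiP k.
by rewrite Gkl Pkl eqxx.
Qed.

Local Open Scope classical_set_scope.

(** If G has an edge, the maximum is the largest of the maxima given by
[eig_ratio_max] over the n - 1 values of m; it is nonnegative, so it also
bounds the quotient 0 that comes from the zero matrix. *)
Lemma eig_ratios_has_max : (1 < n)%N -> exists M, is_max (eig_ratios R G) M.
Proof.
move=> hn.
have inS m B : (0 < m < n)%N -> B \is hermsymmx -> supported G B ->
    eig_ratios R G (eig_ratio B m).
  move=> m0n Bh Bs; exists B, m; split; first exact: Bh.
    by lia.
  by rewrite schur_supported_id.
have h0 := hermsymmx0 R n.
have s0 : supported G (0 : 'M[C]_n) by move=> k l _; rewrite mxE.
(* [unit_coords] is empty when G has no edge; every quotient is then 0. *)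
have [K0|/set0P K0] := eqVneq (@unit_coords R n G) set0.
  exists 0; split; first by rewrite -(@eig_ratio0 1%N); [apply: inS|lia].
  move=> _ [W [m [Wh m0n ->]]]; have {}m0n : (0 < m < n)%N by lia.
  set B := schur_prod _ _.
  have [->|B0] := eqVneq B 0; first by rewrite (eig_ratio0 m0n).
  have [x xK _] :=
    unit_coords_scale (schur_hermsymmx Wh) (@schur_supported W) B0.
  by have : set0 x by rewrite -K0.
have /choice[x xP] : forall m : 'I_n, exists x, (0 < m)%N ->
    unit_coords G x /\ forall B : 'M[C]_n, B \is hermsymmx -> supported G B ->
    B != 0 -> eig_ratio B m <= eig_ratio (herm_of x) m.
  move=> m; have [m0|] := boolP (0 < m)%N; last by exists 0.
  have m0n : (0 < m < n)%N by rewrite m0 ltn_ord.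
  by have [x xK xmax] := eig_ratio_max m0n K0; exists x.
pose F (m : 'I_n) := eig_ratio (herm_of (x m)) m.
have [m0 m0_gt0 Fmax] :=
  @arg_maxP _ R _ (Ordinal hn) (fun m : 'I_n => (0 < m)%N) F isT.
have xS (m : 'I_n) : (0 < m)%N -> supported G (herm_of (x m)).
  by case/xP => -[].
exists (F m0); split.
  by apply: inS (herm_of_herm _) (xS _ m0_gt0); rewrite m0_gt0 ltn_ord.
move=> _ [W [m [Wh m0n ->]]]; have {}m0n : (0 < m < n)%N by lia.
have m0n0 : (0 < m0 < n)%N by rewrite m0_gt0 ltn_ord.
set B := schur_prod _ _.
have [->|B0] := eqVneq B 0.
  have [xK _] := xP _ m0_gt0; have trx := supported_trace0 (xS _ m0_gt0).
  rewrite (eig_ratio0 m0n) /F (eig_ratioE (herm_of_herm _) trx m0n0).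
  have nm0n : (0 < n - m0 < n)%N by lia.
  have top_gt0 := top_sum_mx_gt0 (herm_of_herm _) trx (unit_coords_neq0 xK).
  by rewrite ltW // divr_gt0 // top_gt0.
have /andP[m_gt0 ltmn] := m0n; pose i := Ordinal ltmn.
apply: le_trans (Fmax i m_gt0).
have [_ xmax] := xP i m_gt0.
exact: xmax (schur_hermsymmx Wh) (@schur_supported W) B0.
Qed.

End Bound.

(** The maximum is itself the quotient of some W * A, so it is enough to bound
each quotient by the number of colours minus 1. *)
Theorem theorem1p4 (R : realType) (n : nat) (G : graph n) (hn : (1 < n)%N) :
  exists2 M : R,
    is_max (eig_ratios R G) M & (chromatic_number G)%:R >= 1 + M.
Proof.
have [M Mmax] := eig_ratios_has_max R G hn; exists M => //.
have [[W [m [Wh m0n ->]]] _] := Mmax.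
rewrite /chromatic_number; case: ex_minnP => -[|c] colG _.
  (* A colouring with no colour is impossible, as G has a vertex. *)
  by have /existsP[Phi _] := colG; have [] := Phi (Ordinal hn).
rewrite -nat1r lerD2l.
have {}m0n : (0 < m < n)%N by lia.
have Bs := @schur_supported _ _ G W.
exact: (eig_ratio_le_colours colG (schur_hermsymmx G Wh) Bs m0n).
Qed.
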